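(* Let $\eta,\theta\in\mathbb{R}$, $\tau\ge0$, $q\in[-1,1]$, $t>0$, and put $\alpha=\tau+(1-q)t$, $\beta=\eta\alpha$, $\gamma=\theta-\eta t$. Assume that $\widetilde{\mathbb{H}}\in\mathcal{Q}$ satisfies $$\widetilde{\mathbb{H}}\mathbb{F}=q\,\mathbb{F}\widetilde{\mathbb{H}}+\mathbb{E}+\gamma\widetilde{\mathbb{H}}+\alpha\widetilde{\mathbb{H}}^2+\beta\widetilde{\mathbb{H}}\mathbb{F}\widetilde{\mathbb{H}}\qquad\text{and}\qquad\widetilde{\mathbb{H}}(\mathbb{E}-\mathbb{F}\mathbb{D})=\mathbf{0}.$$ Then for all $z\in\mathbb{R}$ $$\widetilde{\mathbb{H}}=\mathbb{B}(z)\,\mathbb{D}_q\mathbb{W}_1^{-1}\,\mathbb{B}(z)^{-1}.$$ Moreover, for $\widetilde{\mathbb{M}}:=\widetilde{\mathbb{H}}\mathbb{F}-\mathbb{F}\widetilde{\mathbb{H}}$ and all $z\in\mathbb{R}$, $$\widetilde{\mathbb{M}}\,\mathbb{B}(z)\,\mathbb{W}_2\mathbb{W}_3=\mathbb{E}-\mathbb{F}\mathbb{D}+(\mathbb{F}-z\mathbb{E})\,\mathbb{B}(z)\,(\mathbb{D}-\mathsf{Q}).$$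
   Context: $\mathcal{Q}$ is the algebra of all infinite sequences $\mathbb{P}=(P_0,P_1,\dots)$ of real polynomials in one variable $x$, with coordinatewise linear structure and the multiplication: $\mathbb{P}\mathbb{U}$ has $k$-th coordinate $\sum_{j=0}^{\deg U_k}[U_k]_jP_j(x)$, where $[U_k]_j$ is the coefficient of $x^j$ in $U_k$. The identity is $\mathbb{E}=(1,x,x^2,\dots)$; $\mathbf{0}$ is the zero sequence; $\mathbb{D}=(0,1,x,x^2,\dots)$; $\mathbb{F}=(x,x^2,x^3,\dots)$; so $\mathbb{E}-\mathbb{F}\mathbb{D}=(1,0,0,\dots)$. $\mathbb{D}_q:=\sum_{k\ge0}q^k\mathbb{F}^k\mathbb{D}^{k+1}=([0]_q,[1]_q,[2]_qx,[3]_qx^2,\dots)$, where $[n]_q=1+\dots+q^{n-1}$, $[0]_q=0$. $\mathbb{W}_1:=\mathbb{E}+\beta\mathbb{D}_q\mathbb{F}\mathbb{D}_q$, $\mathbb{W}_2:=\mathbb{E}+\beta\mathbb{F}\mathbb{D}_q^2$, $\mathbb{W}_3:=\mathbb{E}+q\beta\mathbb{F}\mathbb{D}_q^2$ (these are invertible in $\mathcal{Q}$). $\mathsf{R}:=(\mathbb{W}_1+\gamma\mathbb{D}_q)\mathbb{W}_2+\alpha\mathbb{D}_q^2$, $\mathsf{Q}:=(1-q)\mathbb{D}_q\mathbb{W}_2-\beta\mathbb{D}_q^2$, and $\mathbb{S}(z):=\mathsf{R}+z(\mathbb{D}-\mathsf{Q})$ for $z\in\mathbb{R}$. For $z\in\mathbb{R}$,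 $\mathbb{B}(z)\in\mathcal{Q}$ is the unique element satisfying $\mathbb{F}\mathbb{B}(z)=\mathbb{B}(z)\mathbb{S}(z)\mathbb{F}$ and $\mathbb{B}(z)(\mathbb{E}-\mathbb{F}\mathbb{D})=\mathbb{E}-\mathbb{F}\mathbb{D}$; its $n$-th coordinate is a monic polynomial of degree $n$ in $x$, and $\mathbb{B}(z)$ is invertible in $\mathcal{Q}$. *)

(* Defs.v *)
From HB Require Import structures.
From mathcomp Require Import all_boot all_order all_algebra.
From mathcomp Require Import zify.
From mathcomp Require Import boolp classical_sets functions.

Set Implicit Arguments.
Unset Strict Implicit.
Unset Printing Implicit Defensive.

Import GRing.Theory.
Local Open Scope ring_scope.

(* Sequences of polynomials.  A sequence P encodes the linear endomorphism    *)
(* 'X^k |-> P k of {poly R}; the product below is composition.  The alias     *)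
(* keeps this product apart from the pointwise one on nat -> {poly R}.        *)
Definition Qalg (R : comNzRingType) : Type := nat -> {poly R}.

Section QAlgebra.
Variable R : comNzRingType.
Implicit Types (P U V : Qalg R) (p : {poly R}) (a : R).

HB.instance Definition _ := Choice.copy (Qalg R) (nat -> {poly R}).
HB.instance Definition _ := GRing.Zmodule.copy (Qalg R) (nat -> {poly R}).

Definition qapply P p : {poly R} := \sum_(j < size p) p`_j *: P j.

Definition qone : Qalg R := fun k => 'X^k.
Definition qmul P U : Qalg R := fun k => qapply P (U k).
Definition qscale a P : Qalg R := fun k => a *: P k.

Lemma qapply_wide n P p : (size p <= n)%N ->
  qapply P p = \sum_(j < n) p`_j *: P j.
Proof.
move=> le_pn; rewrite /qapply (big_ord_widen n (fun j => p`_j *: P j) le_pn).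
rewrite big_mkcond; apply: eq_bigr => j _; case: ltnP => // le_pj.
by rewrite nth_default // scale0r.
Qed.

Fact qapply_is_linear P : linear (qapply P).
Proof.
move=> a p r; pose n := maxn (size p) (size r).
rewrite !(@qapply_wide n) ?leq_maxl ?leq_maxr //; last first.
  by rewrite (leq_trans (size_polyD _ _)) // geq_max leq_maxr
             (leq_trans (size_scale_leq _ _)) // leq_maxl.
rewrite scaler_sumr -big_split; apply: eq_bigr => j _ /=.
by rewrite coefD coefZ scalerDl scalerA.
Qed.
HB.instance Definition _ P :=
  GRing.isLinear.Build R {poly R} {poly R} *:%R (qapply P)
    (qapply_is_linear P).

Lemma qapplyXn P k : qapply P 'X^k = P k.
Proof.
rewrite /qapply size_polyXn big_ord_recr /= coefXn eqxx scale1r big1 ?add0r //.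
by move=> j _; rewrite coefXn ltn_eqF ?scale0r.
Qed.

Lemma qapply_mul P U p : qapply P (qapply U p) = qapply (qmul P U) p.
Proof.
by rewrite [qapply U p]/qapply linear_sum; apply: eq_bigr => j _; rewrite linearZ.
Qed.

Fact qmulA : associative qmul.
Proof. by move=> P U V; apply/funext => k; rewrite /qmul qapply_mul. Qed.
Lemma qapply1 p : qapply qone p = p.
Proof.
by rewrite -[RHS]coefK poly_def.
Qed.
Fact qmul1 : left_id qone qmul.
Proof. by move=> P; apply/funext => k; apply: qapply1. Qed.
Fact qmulr1 : right_id qone qmul.
Proof. by move=> P; apply/funext => k; apply: qapplyXn. Qed.
Lemma qapplyD P U p : qapply (P + U) p = qapply P p + qapply U p.
Proof.
by rewrite -big_split; apply: eq_bigr => j _; apply: scalerDr.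
Qed.
Fact qmulDl : left_distributive qmul +%R.
Proof. by move=> P U V; apply/funext => k; apply: qapplyD. Qed.
Fact qmulDr : right_distributive qmul +%R.
Proof. by move=> P U V; apply/funext => k; apply: linearD. Qed.
Fact qone_neq0 : qone != 0.
Proof.
apply/eqP => /(congr1 (fun P : Qalg R => P 0%N)) /eqP.
by rewrite /qone expr0 oner_eq0.
Qed.
HB.instance Definition _ := GRing.Zmodule_isNzRing.Build (Qalg R)
  qmulA qmul1 qmulr1 qmulDl qmulDr qone_neq0.

Fact qscalerA a b P : qscale a (qscale b P) = qscale (a * b) P.
Proof. by apply/funext => k; apply: scalerA. Qed.
Fact qscale1r : left_id 1 qscale.
Proof. by move=> P; apply/funext => k; apply: scale1r. Qed.
Fact qscalerDr : right_distributive qscale +%R.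
Proof. by move=> a P U; apply/funext => k; apply: scalerDr. Qed.
Fact qscalerDl P : {morph qscale^~ P : a b / a + b}.
Proof. by move=> a b; apply/funext => k; apply: scalerDl. Qed.
HB.instance Definition _ := GRing.Zmodule_isLmodule.Build R (Qalg R)
  qscalerA qscale1r qscalerDr qscalerDl.

Lemma qapplyZ a P p : qapply (a *: P) p = a *: qapply P p.
Proof.
by rewrite scaler_sumr; apply: eq_bigr => j _; rewrite !scalerA mulrC -scalerA.
Qed.
Fact qscalerAl a P U : a *: (P * U) = (a *: P) * U.
Proof. by apply/funext => k; symmetry; apply: qapplyZ. Qed.
HB.instance Definition _ := GRing.Lmodule_isLalgebra.Build R (Qalg R) qscalerAl.
Fact qscalerAr a P U : a *: (P * U) = P * (a *: U).
Proof. by apply/funext => k; symmetry; apply: linearZ. Qed.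
HB.instance Definition _ := GRing.Lalgebra_isAlgebra.Build R (Qalg R) qscalerAr.

(* Invertibility in Qalg R is not decidable: P^-1 is the two-sided inverse of *)
(* P chosen classically when there is one, and P otherwise.                   *)
Definition qunit : pred (Qalg R) :=
  fun P => `[< exists V, V * P = 1 /\ P * V = 1 >].
Definition qinv P : Qalg R := xget P [set V | V * P = 1 /\ P * V = 1].
Fact qmulVr : {in qunit, left_inverse 1 qinv *%R}.
Proof. by move=> P /asboolP /(xgetPex P) []. Qed.
Fact qdivrr : {in qunit, right_inverse 1 qinv *%R}.
Proof. by move=> P /asboolP /(xgetPex P) []. Qed.
Fact qunitP P U : U * P = 1 /\ P * U = 1 -> qunit P.
Proof. by move=> UP; apply/asboolP; exists U. Qed.
Fact qinv_out : {in [predC qunit], qinv =1 id}.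
Proof.
by move=> P /asboolP nP; apply: xgetPN => V VP; apply: nP; exists V.
Qed.
HB.instance Definition _ := GRing.NzRing_hasMulInverse.Build (Qalg R)
  qmulVr qdivrr qunitP qinv_out.

Lemma qalg1E k : (1 : Qalg R) k = 'X^k. Proof. by []. Qed.
Lemma qalg0E k : (0 : Qalg R) k = 0. Proof. by []. Qed.
Lemma qalgDE P U k : (P + U) k = P k + U k. Proof. by []. Qed.
Lemma qalgNE P k : (- P) k = - P k. Proof. by []. Qed.
Lemma qalgZE a P k : (a *: P) k = a *: P k. Proof. by []. Qed.
Lemma qalgME P U k : (P * U) k = \sum_(j < size (U k)) (U k)`_j *: P j.
Proof. by []. Qed.

End QAlgebra.

Section Elements.
Variable R : comNzRingType.
Implicit Types (P U : Qalg R) (p : {poly R}).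

Definition Dseq : Qalg R := fun k => if k is n.+1 then 'X^n else 0.
Definition Fseq : Qalg R := fun k => 'X^(k.+1).

(* \sum_(j >= 0) q ^+ j *: (Fseq ^+ j * Dseq ^+ j.+1): at coordinate k the    *)
(* terms with j >= k vanish (FDseqE), so the series is a finite sum there.    *)
Definition Dq (q : R) : Qalg R :=
  fun k => \sum_(j < k) q ^+ j *: (Fseq ^+ j * Dseq ^+ j.+1) k.

Lemma mulFE P k : (Fseq * P) k = P k * 'X.
Proof.
change (qapply Fseq (P k) = P k * 'X); move: (P k) => p.
rewrite -{2}[p]coefK poly_def mulr_suml; apply: eq_bigr => j _.
by rewrite -scalerAl -exprSr.
Qed.
Lemma mulrFE P k : (P * Fseq) k = P k.+1.
Proof. exact: qapplyXn. Qed.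
Lemma mulrDE P k : (P * Dseq) k = if k is n.+1 then P n else 0.
Proof.
case: k => [|n]; last exact: qapplyXn.
exact: (linear0 (qapply P)).
Qed.

Lemma expDE j k : (Dseq ^+ j) k = if (j <= k)%N then 'X^(k - j) else 0.
Proof.
elim: j k => [|j IHj] k; first by rewrite subn0.
by rewrite exprSr mulrDE; case: k => // n; rewrite IHj ltnS subSS.
Qed.

Lemma FDseqE j k :
  (Fseq ^+ j * Dseq ^+ j.+1) k = if (j < k)%N then 'X^(k.-1) else 0.
Proof.
have expF P : (Fseq ^+ j * P) k = P k * 'X^j.
  elim: j => [|j IHj]; first by rewrite mul1r mulr1.
  by rewrite exprS -mulrA mulFE IHj -mulrA -exprSr.
rewrite expF expDE; case: ltnP => [lt_jk|_]; last by rewrite mul0r.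
by rewrite -exprD subnS; congr 'X^_; lia.
Qed.

Lemma DqE q k : Dq q k = (\sum_(j < k) q ^+ j) *: 'X^(k.-1).
Proof.
by rewrite scaler_suml; apply: eq_bigr => j _; rewrite FDseqE ltn_ord.
Qed.

Lemma oneBFDE k : (1 - Fseq * Dseq) k = (k == 0%N)%:R.
Proof.
rewrite qalgDE qalgNE mulFE qalg1E.
by case: k => [|n] /=; rewrite ?mul0r ?subr0 // -exprSr subrr.
Qed.

Section Operators.
Variables (q alpha beta gamma : R).

Definition W1 : Qalg R := 1 + beta *: (Dq q * Fseq * Dq q).
Definition W2 : Qalg R := 1 + beta *: (Fseq * Dq q ^+ 2).
Definition W3 : Qalg R := 1 + (q * beta) *: (Fseq * Dq q ^+ 2).
Definition Rs : Qalg R := (W1 + gamma *: Dq q) * W2 + alpha *: Dq q ^+ 2.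
Definition Qs : Qalg R := (1 - q) *: (Dq q * W2) - beta *: Dq q ^+ 2.
Definition Ss (z : R) : Qalg R := Rs + z *: (Dseq - Qs).

Definition B_spec (z : R) (B : Qalg R) : Prop :=
  Fseq * B = B * Ss z * Fseq /\
  B * (1 - Fseq * Dseq) = 1 - Fseq * Dseq.

(* Definite description: see B_specP and B_spec_unique.                       *)
Definition Bs (z : R) : Qalg R := xget 0 [set B | B_spec z B].

End Operators.

Definition lowering P := forall k, (size (P k) <= k)%N.
Definition banded P := forall k, (size (P k) <= k.+1)%N.

Lemma size_qapply_lowering P p n :
  lowering P -> (size p <= n)%N -> (size (qapply P p) <= n.-1)%N.
Proof.
move=> lP le_pn; apply: (leq_trans (size_sum _ _ _)); apply/bigmax_leqP => j _.
apply: leq_trans (size_scale_leq _ _) (leq_trans (lP j) _).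
by have := ltn_ord j; lia.
Qed.
Lemma size_qapply_banded P p n :
  banded P -> (size p <= n)%N -> (size (qapply P p) <= n)%N.
Proof.
move=> bP le_pn; apply: (leq_trans (size_sum _ _ _)); apply/bigmax_leqP => j _.
apply: leq_trans (size_scale_leq _ _) (leq_trans (bP j) _).
by have := ltn_ord j; lia.
Qed.

Lemma banded1 : banded 1.
Proof. by move=> k; rewrite qalg1E size_polyXn. Qed.
Lemma lowering_banded P : lowering P -> banded P.
Proof. by move=> lP k; apply: leq_trans (lP k) _. Qed.
Lemma bandedD P U : banded P -> banded U -> banded (P + U).
Proof.
by move=> bP bU k; rewrite (leq_trans (size_polyD _ _)) // geq_max bP bU.
Qed.
Lemma loweringD P U : lowering P -> lowering U -> lowering (P + U).
Proof.
by move=> bP bU k; rewrite (leq_trans (size_polyD _ _)) // geq_max bP bU.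
Qed.
Lemma loweringZ a P : lowering P -> lowering (a *: P).
Proof. by move=> lP k; rewrite (leq_trans (size_scale_leq _ _)). Qed.
Lemma loweringN P : lowering P -> lowering (- P).
Proof. by move=> lP k; rewrite size_polyN. Qed.
Lemma loweringM P U : lowering P -> banded U -> lowering (P * U).
Proof. by move=> lP bU k; apply: (size_qapply_lowering lP (bU k)). Qed.
Lemma lowering_bandedM P U : banded P -> lowering U -> lowering (P * U).
Proof. by move=> bP lU k; apply: (size_qapply_banded bP (lU k)). Qed.

Lemma lowering_D : lowering Dseq.
Proof. by case=> [|n] /=; rewrite ?size_poly0 ?size_polyXn. Qed.
Lemma lowering_Dq q : lowering (Dq q).
Proof.
case=> [|n]; first by rewrite /Dq big_ord0 size_poly0.
by rewrite DqE (leq_trans (size_scale_leq _ _)) ?size_polyXn.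
Qed.
Lemma banded_FDq q : banded (Fseq * Dq q).
Proof.
move=> k; rewrite mulFE; have [->|nz] := eqVneq (Dq q k) 0.
  by rewrite mul0r size_poly0.
by rewrite size_mulX // ltnS lowering_Dq.
Qed.
Lemma lowering_DqFDq q : lowering (Dq q * Fseq * Dq q).
Proof. by rewrite -mulrA; apply: loweringM (lowering_Dq q) (banded_FDq q). Qed.
Lemma lowering_FDq2 q : lowering (Fseq * Dq q ^+ 2).
Proof.
by rewrite expr2 mulrA; apply: lowering_bandedM (banded_FDq q) (lowering_Dq q).
Qed.
Lemma lowering_Dq2 q : lowering (Dq q ^+ 2).
Proof. by apply: loweringM (lowering_Dq q) (lowering_banded (lowering_Dq q)). Qed.

Lemma strong_rec (T : Type) (step : nat -> (nat -> T) -> T) (t0 : T) :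
  (forall n f g, (forall j, (j < n)%N -> f j = g j) -> step n f = step n g) ->
  exists f, forall n, f n = step n f.
Proof.
move=> ext; pose s n := iter n (fun s => rcons s (step (size s) (nth t0 s))) [::].
have size_s n : size (s n) = n by elim: n => //= n IHn; rewrite size_rcons IHn.
have nth_s n m j : (j < n)%N -> (n <= m)%N -> nth t0 (s m) j = nth t0 (s n) j.
  move=> lt_jn; elim: m => [|m IHm]; first by rewrite leqn0 => /eqP <-.
  rewrite leq_eqVlt => /predU1P[<- // | /= le_nm].
  by rewrite nth_rcons size_s (leq_trans lt_jn) // IHm.
exists (fun n => nth t0 (s n.+1) n) => n /=.
rewrite nth_rcons size_s ltnn eqxx; apply: ext => j lt_jn /=.
by rewrite (nth_s j.+1 n).
Qed.

Lemma qapply_unitri U P k : lowering (U - 1) ->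
  qapply P (U k) = P k + \sum_(j < k) (U k)`_j *: P j.
Proof.
move=> lU; have EU : U k = 'X^k + (U - 1) k.
  by rewrite qalgDE qalgNE qalg1E addrC subrK.
have -> : \sum_(j < k) (U k)`_j *: P j = qapply P ((U - 1) k).
  rewrite (qapply_wide _ (lU k)); apply: eq_bigr => j _.
  by rewrite EU coefD coefXn ltn_eqF ?add0r.
by rewrite {1}EU (linearD (qapply P)) /= qapplyXn.
Qed.

Lemma unitri_left_inverse U : lowering (U - 1) ->
  exists2 V, V * U = 1 & lowering (V - 1).
Proof.
move=> lU.
have [|V VE] := @strong_rec {poly R}
  (fun k f => 'X^k - \sum_(j < k) (U k)`_j *: f j) 0.
  by move=> n f g fg; congr (_ - _); apply: eq_bigr => j _; rewrite fg.
exists (V : Qalg R).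
  apply/funext => k; rewrite -[LHS]/(qapply V (U k)) qapply_unitri //.
  by rewrite {1}VE subrK.
elim/ltn_ind=> k IHk; rewrite qalgDE qalgNE qalg1E VE addrAC subrr add0r.
rewrite size_polyN (leq_trans (size_sum _ _ _)) //; apply/bigmax_leqP => j _.
rewrite (leq_trans (size_scale_leq _ _)) // -(subrK ('X^j) (V j)).
rewrite (leq_trans (size_polyD _ _)) // geq_max size_polyXn ltn_ord andbT.
exact: leq_trans (IHk _ (ltn_ord j)) (ltnW (ltn_ord j)).
Qed.

Lemma unitri_unit U : lowering (U - 1) -> U \is a GRing.unit.
Proof.
move=> /unitri_left_inverse[V VU /unitri_left_inverse[W WV _]].
have defU : U = W by rewrite -[LHS]mul1r -WV -mulrA VU mulr1.
by apply/unitrP; exists V; rewrite VU defU WV.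
Qed.

Section OperatorFacts.
Variables (q alpha beta gamma : R).

Lemma lowering_W1 : lowering (W1 q beta - 1).
Proof. by rewrite addrAC subrr add0r; apply: loweringZ (lowering_DqFDq q). Qed.
Lemma lowering_W2 : lowering (W2 q beta - 1).
Proof. by rewrite addrAC subrr add0r; apply: loweringZ (lowering_FDq2 q). Qed.
Lemma lowering_W3 : lowering (W3 q beta - 1).
Proof. by rewrite addrAC subrr add0r; apply: loweringZ (lowering_FDq2 q). Qed.

Lemma W1_unit : W1 q beta \is a GRing.unit.
Proof. exact: unitri_unit lowering_W1. Qed.
Lemma W2_unit : W2 q beta \is a GRing.unit.
Proof. exact: unitri_unit lowering_W2. Qed.
Lemma W3_unit : W3 q beta \is a GRing.unit.
Proof. exact: unitri_unit lowering_W3. Qed.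

Lemma lowering_S z : lowering (Ss q alpha beta gamma z - 1).
Proof.
have lDq := lowering_Dq q; have lDq2 := lowering_Dq2 q.
have bW2 : banded (W2 q beta).
  rewrite -[W2 q beta](subrK 1).
  by apply: bandedD banded1; apply: lowering_banded lowering_W2.
rewrite /Ss addrAC; apply: loweringD; last first.
  apply: loweringZ; apply: loweringD lowering_D _; apply: loweringN.
  apply: loweringD; first by apply: loweringZ; apply: loweringM.
  by apply: loweringN; apply: loweringZ.
rewrite /Rs addrAC; apply: loweringD; last exact: loweringZ.
rewrite -[W1 q beta](subrK 1) -[_ + 1 + _]addrA [1 + _]addrC addrA.
rewrite mulrDl mul1r -addrA; apply: loweringD lowering_W2.
apply: loweringM bW2; apply: loweringD lowering_W1 _; exact: loweringZ.
Qed.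

Lemma B_specE z B : B_spec q alpha beta gamma z B <->
  B 0%N = 1 /\ forall k, B k.+1 =
    B k * 'X - \sum_(j < k.+1) (Ss q alpha beta gamma z k.+1)`_j *: B j.
Proof.
set S := Ss _ _ _ _ z; have lS : lowering (S - 1) by apply: lowering_S.
have eq1 k : (B * S * Fseq) k =
    B k.+1 + \sum_(j < k.+1) (S k.+1)`_j *: B j.
  by rewrite mulrFE; apply: qapply_unitri.
split=> [[FB B0] | [B0 Brec]].
  split=> [|k].
    move/(congr1 (fun P : Qalg R => P 0%N)): B0; rewrite oneBFDE eqxx.
    by rewrite mulrBr mulr1 mulrA qalgDE qalgNE mulrDE subr0.
  by apply/eqP; rewrite eq_sym subr_eq -eq1 -mulFE FB.
split; apply/funext => k; first by rewrite eq1 Brec subrK mulFE.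
rewrite oneBFDE mulrBr mulr1 mulrA qalgDE qalgNE mulrDE.
by case: k => [|k]; rewrite ?subr0 // mulrFE subrr.
Qed.

Lemma B_spec_unique z B B' :
  B_spec q alpha beta gamma z B -> B_spec q alpha beta gamma z B' -> B = B'.
Proof.
move=> /B_specE[B0 Brec] /B_specE[B'0 B'rec]; apply/funext.
elim/ltn_ind=> -[|k] IHk; first by rewrite B0 B'0.
by rewrite Brec B'rec IHk //; congr (_ - _); apply: eq_bigr => j _; rewrite IHk.
Qed.

Lemma B_specP z : B_spec q alpha beta gamma z (Bs q alpha beta gamma z).
Proof.
apply: xgetPex; have [|B BE] := @strong_rec {poly R} (fun k f =>
  if k is n.+1 then f n * 'X -
    \sum_(j < n.+1) (Ss q alpha beta gamma z n.+1)`_j *: f j else 1) 0.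
  case=> // n f g fg; rewrite fg //; congr (_ - _).
  by apply: eq_bigr => j _; rewrite fg.
by exists B; apply/B_specE; split=> [|k]; rewrite BE.
Qed.

Lemma lowering_B z : lowering (Bs q alpha beta gamma z - 1).
Proof.
have /B_specE[B0 Brec] := B_specP z; set B := Bs _ _ _ _ z in B0 Brec *.
elim/ltn_ind=> -[|k] IHk; first by rewrite qalgDE qalgNE B0 subrr size_poly0.
rewrite qalgDE qalgNE Brec qalg1E exprSr addrAC -mulrBl.
rewrite (leq_trans (size_polyD _ _)) // geq_max size_polyN; apply/andP; split.
  have := IHk k (ltnSn k); rewrite qalgDE qalgNE qalg1E.
  have [->|nz] := eqVneq (B k - 'X^k) 0; first by rewrite mul0r size_poly0.
  by rewrite size_mulX.
rewrite (leq_trans (size_sum _ _ _)) //; apply/bigmax_leqP => j _.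
rewrite (leq_trans (size_scale_leq _ _)) // -(subrK ('X^j) (B j)).
rewrite (leq_trans (size_polyD _ _)) // geq_max size_polyXn ltn_ord andbT.
exact: leq_trans (IHk _ (ltn_ord j)) (ltnW (ltn_ord j)).
Qed.

Lemma B_unit z : Bs q alpha beta gamma z \is a GRing.unit.
Proof. exact: unitri_unit (lowering_B z). Qed.

End OperatorFacts.
End Elements.

(* Main.v *)
From HB Require Import structures.
Require Import Defs.
From mathcomp Require Import all_boot all_order all_algebra.
From mathcomp Require Import reals.

Import Order.TTheory GRing.Theory Num.Theory.
Local Open Scope ring_scope.

(** Both identities become purely algebraic after conjugation by [B(z)].  The
    defining relation of [B = B(z)] reads [B^-1 F B = S F] with [S = S(z)],
    so that conjugating by [B] turns the equation of [H] into

      [x (S F) = q (S F) x + 1 + gamma x + alpha x^2 + beta x (S F) x]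

    for [x = B^-1 H B].  This holds for [x = Dq W1^-1], by a computation which
    uses only the q-Weyl relation [Dq F = q F Dq + 1], the relation [D F = 1]
    and the invertibility of [W1].  Since [S] is a linear combination of [W1 W2], [Dq W2],
    [Dq^2] and [D - Q], and since the defect

      [u |-> x u - q u x - beta x u x]

    is linear in [u], it suffices that these four pieces, multiplied by [F],
    have defects [1], [x], [x^2] and [0]: lemma [defect_sop].  The same
    decomposition proves the commutator formula: the linear map
    [u |-> (x u - u x) W2 W3 + u Q] undoes the multiplication by [F] on the
    first three pieces and kills the fourth, so it sends [S F] to [R]
    (lemma [bracket_sop]), and the formula for [M B W2 W3] is the conjugate of
    that fact, rewritten with [S F D = S - (E - F D)].

    What makes the pieces computable is the element [W4 = E + beta Dq^2 F],
    which carries factors across [Dq] and [F]: [W4 Dq = Dq W1], [W2 F = F W4].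
    The first one gives [W4 x = Dq], so that multiplying by [W4], which is
    injective, removes the inverse hidden in [x].  For the piece [D - Q] the
    commutator [Dq F - F Dq], which scales [x^n] by [q^n], enters through
    [(D - Q) F = q (Dq F - F Dq) W4].

    So [B Dq W1^-1 B^-1] solves the equation of [H].  That equation
    determines [H], for it computes coordinate [k + 1] of [H] from the
    coordinates up to [k] once the [k]-th one is known to have degree less
    than [k]; the degree bound follows from the same recursion (lemmas
    [qcr_lowering] and [qcr_unique]). *)

(** * Two elements of an algebra that q-commute *)

Section QWeyl.
Set Implicit Arguments.
Unset Strict Implicit.
Variables (R : comNzRingType) (A : unitAlgType R) (q beta : R) (F d : A).

Definition w1 : A := 1 + beta *: (d * F * d).
Definition w2 : A := 1 + beta *: (F * d ^+ 2).
Definition w3 : A := 1 + (q * beta) *: (F * d ^+ 2).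
(** [w4] and [w5] are [w2] and [w3] with [F] moved across [d ^+ 2]; they are
    what [w2] and [w3] become when pushed to the right of [F] or to the left of
    [d ^+ 2]. *)
Definition w4 : A := 1 + beta *: (d ^+ 2 * F).
Definition w5 : A := 1 + (q * beta) *: (d ^+ 2 * F).
(** When [d] is the q-derivative and [F] the multiplication by [x], this is the
    dilation [p(x) |-> p(q x)]. *)
Definition qdil : A := d * F - F * d.
Definition qop : A := (1 - q) *: (d * w2) - beta *: d ^+ 2.
(** The value found for [B(z)^-1 H B(z)], where [H] solves the equation. *)
Definition sol : A := d / w1.

Hypothesis qcomm : d * F = q *: (F * d) + 1.

Lemma w4_mul_d : w4 * d = d * w1.
Proof.
by rewrite mulrDl mulrDr mul1r mulr1 -scalerAl -scalerAr expr2 !mulrA.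
Qed.

Lemma w2_mul_F : w2 * F = F * w4.
Proof. by rewrite mulrDl mulrDr mul1r mulr1 -scalerAl -scalerAr !mulrA. Qed.

Lemma w1_mul_dF : w1 * (d * F) = d * F * w4.
Proof.
by rewrite mulrDl mulrDr mul1r mulr1 -scalerAl -scalerAr expr2 !mulrA.
Qed.

Lemma w4_mul_d2 : w4 * d ^+ 2 = d ^+ 2 * w2.
Proof. by rewrite mulrDl mulrDr mul1r mulr1 -scalerAl -scalerAr !mulrA. Qed.

Lemma w5_mul_d2 : w5 * d ^+ 2 = d ^+ 2 * w3.
Proof. by rewrite mulrDl mulrDr mul1r mulr1 -scalerAl -scalerAr !mulrA. Qed.

Lemma w4_comm_d2F : w4 * (d ^+ 2 * F) = d ^+ 2 * F * w4.
Proof. by rewrite mulrDl mulrDr mul1r mulr1 -scalerAl -scalerAr. Qed.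

Lemma w2_comm_w3 : w2 * w3 = w3 * w2.
Proof.
have comm : w2 * (F * d ^+ 2) = F * d ^+ 2 * w2.
  by rewrite mulrDl mulrDr mul1r mulr1 -scalerAl -scalerAr.
by rewrite mulrDr [RHS]mulrDl mulr1 mul1r -scalerAl -scalerAr comm.
Qed.

Lemma w1E : w1 = w3 + beta *: d.
Proof.
rewrite /w1 qcomm mulrDl mul1r scalerDr -scalerAl scalerA [beta * q]mulrC.
by rewrite -mulrA -expr2 addrA.
Qed.

(** Differentiating after the dilation costs a factor [q]. *)
Lemma d_mul_qdil : d * qdil = q *: (qdil * d).
Proof.
have qFd : q *: (F * d) = d * F - 1 by rewrite qcomm addrK.
rewrite /qdil mulrBr {1}qcomm mulrDr mulr1 -scalerAr mulrBl scalerBr.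
by rewrite [q *: (F * d * d)]scalerAl qFd mulrBl mul1r opprB !mulrA addrA.
Qed.

(** Both sides are polynomials in [F * d]; going through that fact avoids the
    relation [F * qdil = q^-1 qdil * F], which would need [q] invertible. *)
Lemma dF_comm_qdil : d * F * qdil = qdil * (d * F).
Proof.
have KE : qdil = 1 - (1 - q) *: (F * d).
  by rewrite /qdil qcomm scalerBl scale1r opprB [in RHS]addrA [_ + 1]addrC.
rewrite qcomm mulrDl [RHS]mulrDr mul1r mulr1 KE; congr (_ + _).
by rewrite -scalerAl -scalerAr mulrBr mulrBl mulr1 mul1r -scalerAl -scalerAr.
Qed.

Lemma w4_mul_qdil : w4 * qdil = qdil * w5.
Proof.
rewrite mulrDl [RHS]mulrDr mul1r mulr1 -scalerAl -scalerAr; congr (_ + _).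
rewrite expr2 -[d * d * F]mulrA -[_ * qdil]mulrA dF_comm_qdil mulrA d_mul_qdil.
by rewrite -scalerAl scalerA [beta * q]mulrC -!mulrA.
Qed.

Lemma d3F : d * (d ^+ 2 * F) = q *: (d ^+ 2 * F * d) + d ^+ 2.
Proof.
by rewrite expr2 !mulrA -[d * d * d * F]mulrA qcomm mulrDr mulr1 -scalerAr
  !mulrA.
Qed.

Lemma d_mul_w4 : d * w4 = w5 * d + beta *: d ^+ 2.
Proof.
rewrite mulrDr mulrDl mulr1 mul1r -scalerAl -scalerAr d3F scalerDr scalerA.
by rewrite [beta * q]mulrC addrA.
Qed.

(** The difference between [w3] and [w1] is tuned so that the q-Weyl relation
    survives their insertion; this is what makes the bracket below return
    [u] stripped of its factor [F]. *)
Lemma dF_mul_w3 : d * F * w3 - q *: (F * d * w1) = 1.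
Proof.
rewrite w1E [F * d * _]mulrDr {1}qcomm mulrDl mul1r -scalerAl scalerDr
  -scalerAr.
rewrite scalerA.
by rewrite -[F * d * d]mulrA -expr2 opprD addrACA subrr add0r /w3 addrK.
Qed.

Hypothesis w1_unit : w1 \is a GRing.unit.

Lemma sol_mul_w1 : sol * w1 = d.
Proof. exact: divrK. Qed.

Lemma sol_mul_dF : sol * (d * F * w4) = d ^+ 2 * F.
Proof. by rewrite -w1_mul_dF mulrA sol_mul_w1 mulrA -expr2. Qed.

Lemma w4_mul_sol : w4 * sol = d.
Proof. by rewrite mulrA w4_mul_d mulrK. Qed.

(** [w1 = 1 + beta (d F) d] and [w4 = 1 + beta d (d F)] have the form
    [1 + v d] and [1 + d v], so an inverse of one yields an inverse of the
    other: here [w4^-1 = 1 - beta d w1^-1 (d F)]. *)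
Lemma w4_mulI : injective ( *%R w4).
Proof.
have inv : (1 - beta *: (sol * (d * F))) * w4 = 1.
  by rewrite mulrBl mul1r -scalerAl -[_ * w4]mulrA sol_mul_dF addrK.
by move=> a b /(congr1 ( *%R (1 - beta *: (sol * (d * F)))));
  rewrite ![_ * (w4 * _)]mulrA inv !mul1r.
Qed.

(** Multiplying by [w4] makes a factor [w2] appear on the right of [qop], which
    matches the [w2 * w3] of the bracket. *)
Lemma w4_mul_qop : w4 * qop = d * (w3 - q *: w1) * w2.
Proof.
have -> : w3 - q *: w1 = (1 - q) *: w1 - beta *: d.
  by rewrite scalerBl scale1r {2}w1E [RHS]addrAC addrK.
rewrite /qop [LHS]mulrBr -!scalerAr w4_mul_d2 [w4 * (d * w2)]mulrA w4_mul_d.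
by rewrite [d * (_ - _)]mulrBr [RHS]mulrBl -!scalerAr -!scalerAl expr2.
Qed.

(** * The conjugated equation and the commutator, as linear maps *)

Definition defect (u : A) : A :=
  sol * u - q *: (u * sol) - beta *: (sol * u * sol).

Fact defect_is_linear : linear defect.
Proof.
(* [sol] is generalized so that distributivity does not unfold it *)
move=> a u v; rewrite /defect; move: sol => y.
rewrite [y * _]mulrDr -scalerAr !mulrDl -!scalerAl !scalerDr !scalerN !scalerA.
by rewrite ![a * _]mulrC !opprD [X in X + _ = _]addrACA [LHS]addrACA.
Qed.
HB.instance Definition _ :=
  GRing.isLinear.Build R A A *:%R defect defect_is_linear.

Definition bracket (u : A) : A := (sol * u - u * sol) * (w2 * w3) + u * qop.

Fact bracket_is_linear : linear bracket.
Proof.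
move=> a u v; rewrite /bracket; move: sol (w2 * w3) qop => y w k.
rewrite [y * _]mulrDr -scalerAr [_ * y]mulrDl [_ * k]mulrDl -!scalerAl opprD.
rewrite [X in X * w]addrACA -scalerBr.
by rewrite mulrDl -scalerAl addrACA -scalerDr.
Qed.
HB.instance Definition _ :=
  GRing.isLinear.Build R A A *:%R bracket bracket_is_linear.

Lemma w1_mul_w2F : w1 * w2 * F = w1 * (F * w4).
Proof. by rewrite -mulrA w2_mul_F. Qed.

Lemma defect_w1w2 : defect (w1 * w2 * F) = 1.
Proof.
have w4x u v : u * (v * w4) * sol = u * (v * d) by rewrite -!mulrA w4_mul_sol.
rewrite /defect w1_mul_w2F [sol * _]mulrA sol_mul_w1 !w4x ![d * (F * _)]mulrA.
rewrite -w1_mul_dF {1}qcomm [w1 * (_ + _)]mulrDr mulr1 -scalerAr.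
rewrite [X in X - _]addrAC subrr add0r.
by rewrite /w1 addrK.
Qed.

(** [beta d F d = w1 - 1] and [sol w1 = d] turn the quadratic term into
    [d - sol], whose [d] is absorbed by the q-Weyl relation. *)
Lemma defect_dw2 : defect (d * w2 * F) = sol.
Proof.
have dFw4x : d * F * w4 * sol = d * F * d by rewrite -mulrA w4_mul_sol.
have xdFd : beta *: (sol * (d * F * d)) = d - sol.
  by rewrite -[in RHS]sol_mul_w1 [sol * w1]mulrDr mulr1 -scalerAr addrAC subrr
    add0r.
rewrite /defect -[d * w2 * F]mulrA w2_mul_F [d * (F * w4)]mulrA {1}sol_mul_dF.
rewrite -[sol * _ * sol]mulrA dFw4x xdFd expr2 -[d * d * F]mulrA {1}qcomm.
rewrite [d * (_ + _)]mulrDr mulr1 -scalerAr [d * (F * d)]mulrA.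
rewrite [X in X - _]addrAC subrr add0r.
by rewrite opprB addrCA subrr addr0.
Qed.

(** After multiplication by [w4] the quadratic term is
    [beta d (d^2 F sol) = d (w4 sol - sol) = d^2 - d sol]; the [d^2] is the
    constant produced by [d3F]. *)
Lemma defect_d2 : defect (d ^+ 2 * F) = sol ^+ 2.
Proof.
have bd2F a : beta *: (d ^+ 2 * F * a) = w4 * a - a.
  by rewrite [w4 * a]mulrDl mul1r addrAC subrr add0r scalerAl.
have d2Fx : w4 * (d ^+ 2 * F * sol) = d ^+ 2 * F * d.
  by rewrite mulrA w4_comm_d2F -[LHS]mulrA w4_mul_sol.
apply: w4_mulI; rewrite /defect [LHS]mulrBr [w4 * (_ - _)]mulrBr -!scalerAr.
rewrite [w4 * (sol * _)]mulrA w4_mul_sol d2Fx -[sol * _ * sol]mulrA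
  [w4 * (sol * _)]mulrA.
rewrite w4_mul_sol [beta *: _]scalerAr bd2F w4_mul_sol [d * (d - sol)]mulrBr
  d3F.
rewrite [X in X - _]addrAC subrr add0r opprB addrCA expr2 subrr addr0.
by rewrite expr2 mulrA w4_mul_sol.
Qed.

Lemma qdil_w4_mul_sol : qdil * w4 * sol = qdil * d.
Proof. by rewrite -mulrA w4_mul_sol. Qed.

(** Pushing [qdil] to the left through [d] and [w4] leaves
    [q (d w4 - w5 d - beta d^2)], which is [d_mul_w4]. *)
Lemma defect_qdil : defect (q *: (qdil * w4)) = 0.
Proof.
rewrite linearZ /=; suff -> : defect (qdil * w4) = 0 by rewrite scaler0.
apply: w4_mulI; rewrite mulr0.
rewrite /defect qdil_w4_mul_sol -[sol * _ * sol]mulrA qdil_w4_mul_sol.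
rewrite [w4 * (_ - _)]mulrBr [w4 * (_ - _)]mulrBr -!scalerAr.
rewrite ![w4 * (sol * _)]mulrA w4_mul_sol [w4 * (qdil * _)]mulrA w4_mul_qdil.
rewrite ![d * (qdil * _)]mulrA d_mul_qdil -!scalerAl -[qdil * d * w4]mulrA
  d_mul_w4.
rewrite [qdil * (_ + _)]mulrDr mulrA scalerDr [X in X - _]addrAC subrr add0r.
by rewrite -scalerAr expr2 mulrA !scalerA [q * _]mulrC subrr.
Qed.

(** The three pieces of [rop] all reduce to this after the inverse in [sol] has
    been eliminated; the bracket then drops to [dF_mul_w3]. *)
Lemma bracket_core a : a * qdil * (w2 * w3) + a * F * (w4 * qop) = a * w2.
Proof.
rewrite w4_mul_qop w2_comm_w3 ![_ * (_ * w2)]mulrA -mulrDl; congr (_ * w2).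
rewrite -!mulrA -mulrDr -[RHS]mulr1; congr (a * _).
rewrite -dF_mul_w3 [w3 - _ in LHS]lock /qdil mulrBl -lock !mulrBr.
by rewrite -!scalerAr !mulrA addrA subrK.
Qed.

Lemma bracket_w1w2 : bracket (w1 * w2 * F) = w1 * w2.
Proof.
rewrite -[RHS]bracket_core /bracket w1_mul_w2F [sol * _]mulrA sol_mul_w1
  [w1 * (F * w4)]mulrA.
rewrite -[w1 * F * w4 * sol]mulrA w4_mul_sol -[w1 * F * w4 * qop]mulrA.
by rewrite [d * (F * w4)]mulrA -w1_mul_dF -[w1 * F * d]mulrA
  -[w1 * _ - _]mulrBr.
Qed.

Lemma bracket_dw2 : bracket (d * w2 * F) = d * w2.
Proof.
rewrite -[RHS]bracket_core /bracket -[d * w2 * F]mulrA w2_mul_F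
  [d * (F * w4)]mulrA.
rewrite {1}sol_mul_dF -[d * F * w4 * sol]mulrA w4_mul_sol
  -[d * F * w4 * qop]mulrA.
by rewrite expr2 -[d * d * F]mulrA -[d * F * d]mulrA -[d * _ - _]mulrBr.
Qed.

Lemma bracket_d2 : bracket (d ^+ 2 * F) = d ^+ 2.
Proof.
apply: w4_mulI; rewrite w4_mul_d2 -[RHS]bracket_core /bracket.
rewrite [LHS]mulrDr [w4 * (_ * (w2 * w3))]mulrA [w4 * (_ - _)]mulrBr.
rewrite [w4 * (sol * _)]mulrA [w4 * (_ * sol)]mulrA [w4 * (_ * qop)]mulrA
  w4_mul_sol.
rewrite w4_comm_d2F -![d ^+ 2 * F * w4 * _]mulrA w4_mul_sol
  -[d ^+ 2 * F * d]mulrA.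
by rewrite [d * _]mulrA -exprS exprSr -[d ^+ 2 * d * F]mulrA
  -[d ^+ 2 * _ - _]mulrBr.
Qed.

Lemma d_mul_w4_w3 : d * w4 * w3 = w5 * d * w1.
Proof.
rewrite d_mul_w4 [LHS]mulrDl w1E [RHS]mulrDr -scalerAl -scalerAr.
by rewrite -[w5 * d * d]mulrA -expr2 w5_mul_d2.
Qed.

Lemma bracket_qdil : bracket (q *: (qdil * w4)) = 0.
Proof.
rewrite linearZ /=; suff -> : bracket (qdil * w4) = 0 by rewrite scaler0.
apply: w4_mulI; rewrite mulr0 /bracket.
rewrite [LHS]mulrDr [w4 * (_ * (w2 * w3))]mulrA [w4 * (_ - _)]mulrBr.
rewrite [w4 * (sol * _)]mulrA w4_mul_sol -[qdil * w4 * sol]mulrA w4_mul_sol.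
rewrite -[qdil * w4 * qop]mulrA w4_mul_qop ![w4 * (qdil * _)]mulrA w4_mul_qdil.
rewrite [d * (qdil * _)]mulrA d_mul_qdil -scalerAl w2_comm_w3.
rewrite ![_ * (_ * w2)]mulrA -mulrDl.
suff -> : (q *: (qdil * d * w4) - qdil * w5 * d) * w3
          + qdil * w5 * (d * (w3 - q *: w1)) = 0 by rewrite mul0r.
rewrite [qdil * w5 * (d * _)]mulrA mulrBl [_ * (w3 - _)]mulrBr addrA subrK
  -scalerAr.
by rewrite -scalerAl -!mulrA [d * (w4 * w3)]mulrA d_mul_w4_w3 -!mulrA subrr.
Qed.

(** * The operator S(z) and the conjugation by B(z) *)

Variables (D : A) (alpha gamma z : R).
Hypothesis D_mul_F : D * F = 1.
Hypothesis d_mul_P0 : d * (1 - F * D) = 0.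

Definition rop : A := (w1 + gamma *: d) * w2 + alpha *: d ^+ 2.
Definition sop : A := rop + z *: (D - qop).

(** [D F = 1], and [qop F] is a right multiple of [w4] up to
    [beta d^2 F = w4 - 1], so [w4] factors out and leaves
    [1 - (1 - q) d F = q qdil]. *)
Lemma D_sub_qop_mul_F : (D - qop) * F = q *: (qdil * w4).
Proof.
have qK : q *: qdil = 1 - (1 - q) *: (d * F).
  have qFd : q *: (F * d) = d * F - 1 by rewrite qcomm addrK.
  by rewrite /qdil scalerBr qFd scalerBl scale1r !opprB addrCA.
rewrite scalerAl qK mulrBl D_mul_F /qop [X in _ - X]mulrBl -!scalerAl.
rewrite -[d * w2 * F]mulrA w2_mul_F opprB [RHS]mulrBl mul1r -scalerAl mulrA.
by rewrite addrA.
Qed.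

Lemma sop_mul_F :
  sop * F = w1 * w2 * F + gamma *: (d * w2 * F) + alpha *: (d ^+ 2 * F)
            + z *: (q *: (qdil * w4)).
Proof.
by rewrite -D_sub_qop_mul_F /sop /rop [LHS]mulrDl [X in X + _]mulrDl !scalerAl
  -!mulrDl.
Qed.

Lemma defect_sop : defect (sop * F) = 1 + gamma *: sol + alpha *: sol ^+ 2.
Proof.
rewrite sop_mul_F !linearD [_ (z *: _)]linearZ [_ (gamma *: _)]linearZ.
rewrite [_ (alpha *: _)]linearZ /= defect_w1w2 defect_dw2 defect_d2 defect_qdil.
by rewrite scaler0 addr0.
Qed.

Lemma bracket_sop : bracket (sop * F) = rop.
Proof.
rewrite sop_mul_F !linearD [_ (z *: _)]linearZ [_ (gamma *: _)]linearZ.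
rewrite [_ (alpha *: _)]linearZ /= bracket_w1w2 bracket_dw2 bracket_d2
  bracket_qdil.
by rewrite scaler0 addr0 scalerAl -mulrDl.
Qed.

Lemma w1_mul_P0 : w1 * (1 - F * D) = 1 - F * D.
Proof.
rewrite mulrDl mul1r -scalerAl -[_ * (1 - _)]mulrA d_mul_P0 mulr0.
by rewrite scaler0 addr0.
Qed.

(** [1 - F * D] is the projection to the coordinate 0, where all the lowering
    terms of [sop] vanish. *)
Lemma sop_mul_P0 : sop * (1 - F * D) = 1 - F * D.
Proof.
have DP0 : D * (1 - F * D) = 0.
  by rewrite mulrBr mulr1 mulrA D_mul_F mul1r subrr.
move: (1 - F * D) d_mul_P0 DP0 w1_mul_P0 => p dp Dp w1p.
have d2p : d ^+ 2 * p = 0 by rewrite expr2 -mulrA dp mulr0.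
have w2p : w2 * p = p.
  by rewrite mulrDl mul1r -scalerAl -mulrA d2p mulr0 scaler0 addr0.
have qsp : qop * p = 0.
  by rewrite mulrBl -!scalerAl -mulrA w2p dp d2p !scaler0 subrr.
rewrite mulrDl -scalerAl [(D - qop) * p]mulrBl Dp qsp subrr scaler0 addr0.
rewrite mulrDl -mulrA w2p -scalerAl d2p scaler0 addr0.
by rewrite mulrDl w1p -scalerAl dp scaler0 addr0.
Qed.

(* [b] stands for [B(z)]: these are its two defining relations. *)
Variable b : A.
Hypothesis b_unit : b \is a GRing.unit.
Hypothesis F_mul_b : F * b = b * sop * F.
Hypothesis b_mul_P0 : b * (1 - F * D) = 1 - F * D.

(** [F_mul_b] makes [F] the conjugate of [sop * F], so every term of the
    equation is a conjugate and [defect_sop] applies. *)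
Lemma conj_solution : let h := b * sol * b^-1 in
  h * F = q *: (F * h) + 1 + gamma *: h + alpha *: h ^+ 2 + beta *: (h * F * h)
  /\ h * (1 - F * D) = 0.
Proof.
move=> h.
have conjM u v : b * u * b^-1 * (b * v * b^-1) = b * (u * v) * b^-1.
  by rewrite -!mulrA mulKr // !mulrA.
have defF : F = b * (sop * F) * b^-1 by rewrite mulrA -F_mul_b mulrK.
split.
  have := defect_sop; rewrite {}/h /defect; move: sol (sop * F) defF => y u ->
    /eqP.
  rewrite !subr_eq => /eqP xu; rewrite !conjM expr2 conjM {1}xu.
  rewrite !(mulrDl, mulrDr) -!scalerAr -!scalerAl mulr1 mulrV // -expr2.
  by rewrite addrC !addrA.
have bVp : b^-1 * (1 - F * D) = 1 - F * D by rewrite -{1}b_mul_P0 mulKr.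
rewrite /h -mulrA bVp -mulrA /sol -mulrA -{1}w1_mul_P0 mulKr //.
by rewrite d_mul_P0 mulr0.
Qed.

Lemma conj_commutator : let h := b * sol * b^-1 in
  (h * F - F * h) * b * w2 * w3 = 1 - F * D + (F - z *: 1) * b * (D - qop).
Proof.
move=> h; have defF : F = b * (sop * F) * b^-1 by rewrite mulrA -F_mul_b mulrK.
have -> : (h * F - F * h) * b = b * (sol * (sop * F) - sop * F * sol).
  rewrite /h {1 2}defF mulrBl !mulrA !mulrVK // -!mulrA.
  by rewrite [in RHS]mulrBr !mulrA.
have -> : (F - z *: 1) * b * (D - qop)
          = b * (sop * F * (D - qop) - z *: (D - qop)).
  rewrite [_ * b]mulrBl -scalerAl mul1r F_mul_b [LHS]mulrBl -scalerAl.
  by rewrite [RHS]mulrBr -scalerAr !mulrA.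
have sFD : sop * F * D = sop - (1 - F * D).
  by rewrite -sop_mul_P0 [sop * (_ - _)]mulrBr mulr1 opprB addrC subrK mulrA.
have E : (sol * (sop * F) - sop * F * sol) * w2 * w3 = rop - sop * F * qop.
  by rewrite -bracket_sop /bracket addrK [RHS]mulrA.
rewrite -[b * _ * w2]mulrA -[b * _ * w3]mulrA E -{1}b_mul_P0 -[RHS]mulrDr.
congr (b * _); rewrite [sop * F * (D - _)]mulrBr sFD.
move: (sop * F * qop) (1 - F * D) => a p; rewrite /sop; move: rop (z *: _) =>
  y v.
by rewrite [y + v - p - a - v]addrAC [y + v - p - v]addrAC addrK addrA
  [p + _]addrC subrK.
Qed.

End QWeyl.

(** * The equation determines its solution *)

Section Recursion.
Set Implicit Arguments.
Unset Strict Implicit.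
Variables (R : comNzRingType) (q alpha beta gamma : R).
Implicit Types H P U : Qalg R.

Definition qcr H : Prop :=
  H * Fseq R = q *: (Fseq R * H) + 1 + gamma *: H + alpha *: H ^+ 2
               + beta *: (H * Fseq R * H) /\
  H * (1 - Fseq R * Dseq R) = 0.

Lemma mul_oneBFD P : P * (1 - Fseq R * Dseq R) = 0 <-> P 0%N = 0.
Proof.
split=> [/(congr1 (fun U : Qalg R => U 0%N))|P0].
  by rewrite mulrBr mulr1 mulrA qalgDE qalgNE mulrDE subr0.
apply/boolp.funext => k; rewrite mulrBr mulr1 mulrA qalgDE qalgNE mulrDE.
by case: k => [|k]; rewrite ?subr0 // mulrFE subrr.
Qed.

(** Multiplication by [F] on the right shifts the coordinates, so the equation
    is a recursion; its quadratic terms only see [H] on polynomials of degree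
    at most [k], provided that [H k] has degree less than [k]. *)
Lemma qcrS H k : qcr H -> H k.+1 = q *: (H k * 'X) + 'X^k + gamma *: H k
  + alpha *: qapply H (H k) + beta *: qapply H (H k * 'X).
Proof.
case=> eqH _; have := congr1 (fun P : Qalg R => P k) eqH.
rewrite mulrFE !qalgDE !qalgZE mulFE -mulrA expr2.
by rewrite -[(H * (Fseq R * H)) k]/(qapply H ((Fseq R * H) k)) mulFE.
Qed.

Lemma eq_qapply_lt n P U (p : {poly R}) :
  (size p <= n)%N -> (forall j, (j < n)%N -> P j = U j) ->
  qapply P p = qapply U p.
Proof.
move=> le_pn eqPU; apply: eq_bigr => j _.
by rewrite eqPU // (leq_trans (ltn_ord j)).
Qed.

Lemma size_qapply_lt n m P (p : {poly R}) : (size p <= n)%N ->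
  (forall j, (j < n)%N -> (size (P j) <= m)%N) -> (size (qapply P p) <= m)%N.
Proof.
move=> le_pn leP; apply: leq_trans (size_sum _ _ _) _.
apply/bigmax_leqP => j _; apply: leq_trans (size_scale_leq _ _) (leP _ _).
exact: leq_trans (ltn_ord j) le_pn.
Qed.

Lemma size_mulX_leq (p : {poly R}) n :
  (size p <= n)%N -> (size (p * 'X)%R <= n.+1)%N.
Proof.
have [->|p_neq0] := eqVneq p 0; first by rewrite mul0r size_poly0.
by rewrite size_mulX.
Qed.

(** By induction every term of the recursion has degree at most [k], the degree
    of ['X^k]. *)
Lemma qcr_lowering H : qcr H -> lowering H.
Proof.
move=> qcrH; elim/ltn_ind=> -[|k] IHk.
  by have [_ /mul_oneBFD ->] := qcrH; rewrite size_poly0.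
have sH := IHk k (ltnSn k).
have leH j : (j < k.+1)%N -> (size (H j) <= k.+1)%N.
  by move=> lt_jk; apply: leq_trans (IHk j lt_jk) (ltnW lt_jk).
have sZ (a : R) (p : {poly R}) :
    (size p <= k.+1)%N -> (size (a *: p)%R <= k.+1)%N.
  exact: leq_trans (size_scale_leq _ _).
have sD (p r : {poly R}) : (size p <= k.+1)%N -> (size r <= k.+1)%N ->
    (size (p + r)%R <= k.+1)%N.
  by move=> sp sr; rewrite (leq_trans (size_polyD _ _)) // geq_max sp.
rewrite qcrS //; have sHX := size_mulX_leq sH; have sH' := leqW sH.
have sX : (size ('X^k : {poly R}) <= k.+1)%N by rewrite size_polyXn.
by rewrite !(sD, sZ) ?(size_qapply_lt sH' leH) ?(size_qapply_lt sHX leH).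
Qed.

Lemma qcr_unique H H' : qcr H -> qcr H' -> H = H'.
Proof.
move=> qcrH qcrH'; apply/boolp.funext; elim/ltn_ind=> -[|k] IHk.
  by have [_ /mul_oneBFD ->] := qcrH; have [_ /mul_oneBFD ->] := qcrH'.
have sH := qcr_lowering qcrH k; have sHX := size_mulX_leq sH.
rewrite !qcrS // -(IHk k) // (eq_qapply_lt (leqW sH) IHk).
by rewrite (eq_qapply_lt sHX IHk).
Qed.

Lemma Dq_qcomm : Dq q * Fseq R = q *: (Fseq R * Dq q) + 1.
Proof.
apply/boolp.funext => k; rewrite mulrFE qalgDE qalgZE mulFE qalg1E !DqE /=.
case: k => [|k].
  by rewrite big_ord0 scale0r mul0r scaler0 add0r big_ord1 scale1r.
rewrite -scalerAl -exprSr scalerA big_ord_recl expr0 mulr_sumr addrC.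
rewrite scalerDl scale1r; congr (_ *: _ + _).
by apply: eq_bigr => i _; rewrite exprS.
Qed.

Lemma Dseq_mul_Fseq : Dseq R * Fseq R = 1.
Proof. by apply/boolp.funext => k; rewrite mulrFE. Qed.

Lemma Dq_mul_oneBFD : Dq q * (1 - Fseq R * Dseq R) = 0.
Proof. by apply/mul_oneBFD; rewrite DqE big_ord0 scale0r. Qed.

End Recursion.

Theorem theorem3p2 (R : realType) (eta theta tau q t alpha beta gamma : R)
    (H : Qalg R) :
  0 <= tau -> -1 <= q <= 1 -> 0 < t ->
  alpha = tau + (1 - q) * t -> beta = eta * alpha -> gamma = theta - eta * t ->
  H * Fseq R = q *: (Fseq R * H) + 1 + gamma *: H + alpha *: H ^+ 2
               + beta *: (H * Fseq R * H) ->
  H * (1 - Fseq R * Dseq R) = 0 ->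
  (forall z : R,
     H = Bs q alpha beta gamma z * Dq q * (W1 q beta)^-1
         * (Bs q alpha beta gamma z)^-1) /\
  (let M := H * Fseq R - Fseq R * H in
   forall z : R,
     M * Bs q alpha beta gamma z * W2 q beta * W3 q beta
     = 1 - Fseq R * Dseq R
       + (Fseq R - z *: 1) * Bs q alpha beta gamma z * (Dseq R - Qs q beta)).
Proof.
move=> _ _ _ _ _ _ eqH H0.
have HE z : H = Bs q alpha beta gamma z * (Dq q / W1 q beta)
                / Bs q alpha beta gamma z.
  have [FB B0] := B_specP q alpha beta gamma z.
  apply: (@qcr_unique _ q alpha beta gamma) => //.
  exact: (conj_solution (Dq_qcomm q) (W1_unit q beta) (Dseq_mul_Fseq R)
            (Dq_mul_oneBFD q) (B_unit q alpha beta gamma z) FB B0).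
split=> [z|M z]; first by rewrite -[_ * _ / W1 q beta]mulrA -HE.
have [FB B0] := B_specP q alpha beta gamma z; rewrite /M (HE z).
exact: (conj_commutator (Dq_qcomm q) (W1_unit q beta) (Dseq_mul_Fseq R)
          (Dq_mul_oneBFD q) (B_unit q alpha beta gamma z) FB B0).
Qed.
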